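(* Let $H$ be a real Hilbert space, $N$ a positive integer, $\Lambda = \{i \in \mathbb{N} : 1 \leq i \leq N\}$, $S_i \colon H \to H$ a strongly quasinonexpansive mapping for each $i \in \Lambda$, and $F = \bigcap_{i \in \Lambda} \operatorname{F}(S_i)$ the set of common fixed points of $\{S_i\}_{i \in \Lambda}$. Suppose that $F$ is nonempty and $\hat{\operatorname{F}}(S_i) = \operatorname{F}(S_i)$ for all $i \in \Lambda$. Let $u \in H$, let $\{\alpha_n\}$ be a sequence in $(0,1]$, and let $\{x_n\}$ be a sequence defined by $x_1 \in H$ and $$ \begin{cases} i_n \in \arg\max \{ \lVert S_i x_n - x_n \rVert : i \in \Lambda \}; \\ x_{n+1} = \alpha_n u + (1-\alpha_n) S_{i_n} x_n \end{cases} $$ for $n \in \mathbb{N}$ (where $i_n$ is any choice of an element of the indicated set). If $\sum_n \alpha_n = \infty$ and $\lim_n \alpha_n = 0$, then $\{x_n\}$ converges strongly to $P_F(u)$.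
   Context: $\mathbb{N}$ is the set of positive integers. For a mapping $T \colon C \to H$ defined on a nonempty subset $C$ of $H$ (here $C = H$): - $\operatorname{F}(T) = \{z \in C : Tz = z\}$ is the set of fixed points of $T$. - A point $z \in C$ is an asymptotic fixed point of $T$ if there exists a sequence $\{y_n\}$ in $C$ such that $y_n - T y_n \to 0$ strongly and $y_n \rightharpoonup z$ (weak convergence). The set of asymptotic fixed points of $T$ is denoted by $\hat{\operatorname{F}}(T)$. - $T$ is quasinonexpansive if $\operatorname{F}(T) \neq \emptyset$ and $\lVert Tx - z\rVert \leq \lVert x - z\rVert$ for all $x \in C$ and $z \in \operatorname{F}(T)$. If $C$ is closed and convex and $T$ is quasinonexpansive, then $\operatorname{F}(T)$ is closed and convex. - $T$ is strongly quasinonexpansive if $T$ is quasinonexpansive and $T y_n - y_n \to 0$ whenever $\{y_n\}$ is a bounded sequence in $C$ and $\lVert y_n - p\rVert - \lVert T y_n - p\rVert \to 0$ for some point $p \in \operatorname{F}(T)$. For a nonempty closed convex subset $D$ of $H$, $P_D$ denotes the metric projection of $H$ onto $D$: $P_D(x)$ is the unique point of $D$ with $\lVert x - P_D(x)\rVert = \min\{\lVert x-y\rVert : y \in D\}$. *)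

(* Defs.v *)
From HB Require Import structures.
From mathcomp Require Import all_boot all_order all_algebra sesquilinear.
From mathcomp Require Import all_classical all_reals all_analysis.

Set Implicit Arguments.
Unset Strict Implicit.
Unset Printing Implicit Defensive.

Import Order.TTheory GRing.Theory Num.Theory.
Import numFieldNormedType.Exports.

Local Open Scope classical_set_scope.
Local Open Scope ring_scope.

(* A real Hilbert space is a complete normed module together with a
   positive definite symmetric bilinear form [dot] (a [{dot H for idfun}])
   that induces the norm. *)
Definition induces_norm (R : realType) (H : normedModType R)
    (dot : {dot H for @idfun R}) : Prop :=
  forall x : H, `|x| ^+ 2 = dot x x.

Definition Fix (T : Type) (f : T -> T) : set T := [set z | f z = z].

Definition weakly_cvg (R : realType) (H : normedModType R)
    (y : nat -> H) (z : H) : Prop :=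
  forall f : {linear H -> R^o}, continuous f -> (fun n => f (y n)) @ \oo --> f z.

Definition asymptotic_Fix (R : realType) (H : normedModType R)
    (T : H -> H) : set H :=
  [set z | exists y : nat -> H,
    (fun n => y n - T (y n)) @ \oo --> (0 : H) /\ weakly_cvg y z].

Definition quasinonexpansive (R : realType) (H : normedModType R)
    (T : H -> H) : Prop :=
  Fix T !=set0 /\ forall x z, Fix T z -> `|T x - z| <= `|x - z|.

Definition strongly_quasinonexpansive (R : realType) (H : normedModType R)
    (T : H -> H) : Prop :=
  quasinonexpansive T /\
  forall y : nat -> H, bounded_fun y ->
    (exists2 p, Fix T p &
      (fun n => `|y n - p| - `|T (y n) - p|) @ \oo --> (0 : R)) ->
    (fun n => T (y n) - y n) @ \oo --> (0 : H).

Definition argmax (R : realType) (I : Type) (g : I -> R) : set I :=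
  [set i | forall j, g j <= g i].

Definition nearest_points (R : realType) (H : normedModType R)
    (D : set H) (x : H) : set H :=
  [set p | D p /\ forall y, D y -> `|x - p| <= `|x - y|].

(* The default value 0 is taken only when [nearest_points D x] is empty; in a
   Hilbert space it is a singleton if D is nonempty, closed and convex. *)
Definition metric_projection (R : realType) (H : normedModType R)
    (D : set H) (x : H) : H :=
  xget 0 (nearest_points D x).

(* Main.v *)
(* Put w = P_F(u) and s_n = |x_n - w|^2.  Given e > 0, for all large n
     s_{n+1} <= (1 - alpha_n) s_n + 5 alpha_n e,
   which forces s_n <= 10 e eventually because the alpha_n have infinite sum.
   If |x_n - w| - |S_{i_n} x_n - w| is bounded below, the strict decrease beats
   the perturbation by alpha_n.  Otherwise strong quasinonexpansiveness makes
   the largest residual |S_{i_n} x_n - x_n|, hence all residuals, small, and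
   then <u - w, x_n - w> <= e: a bounded sequence violating this would have a
   weak subsequential limit z in every asymptotic fixed point set, so z in F
   and <u - w, z - w> <= 0 by the characterisation of the projection. *)

Require Import Defs.
From HB Require Import structures.
From mathcomp Require Import all_boot all_order all_algebra sesquilinear.
From mathcomp Require Import all_classical all_reals all_analysis.
From mathcomp Require Import ring lra.

Set Implicit Arguments.
Unset Strict Implicit.
Unset Printing Implicit Defensive.

Import Order.TTheory GRing.Theory Num.Theory.
Import numFieldNormedType.Exports.

Local Open Scope classical_set_scope.
Local Open Scope ring_scope.

(** * Inner product geometry and the variational inequality for nearest points *)

Section InnerProduct.
Context (R : realType) (H : normedModType R) (dot : {dot H for @idfun R})
  (dot_norm : induces_norm dot).
Implicit Types (x y z : H) (C : set H).

Lemma dotC x y : dot x y = dot y x.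
Proof. by rewrite (hermC dot) expr0 mul1r. Qed.

Lemma dotZl a x y : dot (a *: x) y = a * dot x y.
Proof. by rewrite linearZl_LR. Qed.

Lemma dotZr a x y : dot x (a *: y) = a * dot x y.
Proof. by rewrite linearZr_LR. Qed.

Lemma sqnormD x y : `|x + y| ^+ 2 = `|x| ^+ 2 + 2 * dot x y + `|y| ^+ 2.
Proof. by rewrite !dot_norm linearDl/= !linearDr/= (dotC y x); ring. Qed.

Lemma sqnormB x y : `|x - y| ^+ 2 = `|x| ^+ 2 - 2 * dot x y + `|y| ^+ 2.
Proof. by rewrite sqnormD normrN linearNr; ring. Qed.

Lemma sqnormZ a x : `|a *: x| ^+ 2 = a ^+ 2 * `|x| ^+ 2.
Proof. by rewrite normrZ exprMn real_normK ?num_real. Qed.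

Lemma parallelogram x y :
  `|x + y| ^+ 2 + `|x - y| ^+ 2 = 2 * `|x| ^+ 2 + 2 * `|y| ^+ 2.
Proof. by rewrite sqnormD sqnormB; ring. Qed.

(** Expanding the square of the norm of [|y| x - |x| y] gives [2 |x| |y| (|x| |y| - dot x y)], which
    is therefore nonnegative. *)
Lemma dot_le x y : dot x y <= `|x| * `|y|.
Proof.
have [->|x0] := eqVneq x 0; first by rewrite linear0l normr0 mul0r.
have [->|y0] := eqVneq y 0; first by rewrite linear0r normr0 mulr0.
have := sqr_ge0 `| `|y| *: x - `|x| *: y|.
rewrite sqnormB !sqnormZ dotZl dotZr.
have : 0 < `|x| * `|y| by rewrite mulr_gt0 ?normr_gt0.
set a := `|x|; set b := `|y|; set c := dot x y => ab.
have -> : b ^+ 2 * a ^+ 2 - 2 * (b * (a * c)) + a ^+ 2 * b ^+ 2 =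
  2 * (a * b) * (a * b - c) by ring.
by rewrite pmulr_rge0 ?subr_ge0// mulr_gt0.
Qed.

Lemma cauchy_schwarz x y : `|dot x y| <= `|x| * `|y|.
Proof.
rewrite ler_norml dot_le andbT lerNl -linearNl.
by rewrite (le_trans (dot_le _ _))// normrN.
Qed.

Lemma nearest_variational C x p :
  (forall a b t, C a -> C b -> 0 <= t <= 1 -> C (a + t *: (b - a))) ->
  nearest_points C x p -> forall y, C y -> dot (x - p) (y - p) <= 0.
Proof.
move=> Cconv [Cp pmin] y Cy; rewrite leNgt; apply/negP.
set c := dot _ _ => c0.
set q := `|y - p| ^+ 2.
have q0 : 0 <= q by rewrite sqr_ge0.
(* Moving from [p] towards [y] by [t] changes the squared distance to [x] by [t (t q - 2 c)]. This
   [t] gives [t q < c], so the distance would drop below the minimum. *)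
set t := Num.min 1 (c / (q + 1)).
have q1 : 0 < q + 1 by lra.
have t0 : 0 < t by rewrite lt_min ltr01/= divr_gt0.
have t1 : t <= 1 by rewrite ge_min lexx.
have tc : t * (q + 1) <= c by rewrite -ler_pdivlMr// ge_min lexx orbT.
have /pmin : C (p + t *: (y - p)) by apply: Cconv => //; rewrite ltW.
rewrite opprD addrA -(@ler_sqr _ `|x - p|) ?nnegrE//.
rewrite (sqnormB (x - p)) sqnormZ dotZr -/c -/q.
have -> : `|x - p| ^+ 2 - 2 * (t * c) + t ^+ 2 * q =
  `|x - p| ^+ 2 + t * (t * q - 2 * c) by ring.
rewrite lerDl pmulr_rge0// => h; nra.
Qed.

End InnerProduct.

(** * Nearest points, orthogonal projection and Riesz representation *)

Section Hilbert.
Context (R : realType) (H : completeNormedModType R)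
  (dot : {dot H for @idfun R}) (dot_norm : induces_norm dot).
Implicit Types (x y z : H) (C V : set H).

Lemma nearest_points_neq0 C x : closed C -> C !=set0 ->
  (forall a b t, C a -> C b -> 0 <= t <= 1 -> C (a + t *: (b - a))) ->
  nearest_points C x !=set0.
Proof.
move=> Ccl [c0 Cc0] Cconv.
pose D := [set `|x - y| | y in C].
have D_inf : has_inf D.
  split; first by exists `|x - c0|, c0.
  by exists 0 => _ [y _ <-].
pose d := inf D.
have dle y : C y -> d <= `|x - y|.
  by move=> Cy; apply: ge_inf; [case: D_inf | exists y].
have d0 : 0 <= d by apply: lb_le_inf; [case: D_inf | move=> _ [y _ <-]].
have /choice[y yP] n : exists y, C y /\ `|x - y| < d + n.+1%:R^-1.
  have [|_ [y Cy <-]] := @inf_adherent _ D n.+1%:R^-1 _ D_inf.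
    by rewrite invr_gt0.
  by exists y.
(* The midpoint of [a] and [b] lies in [C], hence at distance at least [d] from [x]. The
   parallelogram law then bounds [|a - b|^2] by [4 (d + e)^2 - 4 d^2], which makes the minimizing
   sequence Cauchy. *)
have close a b e : 0 < e -> C a -> C b ->
    `|x - a| <= d + e -> `|x - b| <= d + e ->
    `|a - b| ^+ 2 <= 4 * e * (2 * d + e).
  move=> e0 Ca Cb xa xb.
  have Cm : C (a + 2^-1 *: (b - a)) by apply: Cconv => //; lra.
  have := parallelogram dot_norm (x - a) (x - b).
  have -> : x - a - (x - b) = - (a - b) by rewrite !opprB addrC addrA subrK.
  have -> : x - a + (x - b) = 2 *: (x - (a + 2^-1 *: (b - a))).
    rewrite scalerBr scalerDr scalerA mulfV// scale1r !scaler_nat !mulr2n.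
    have -> : a + a + (b - a) = b + a by rewrite addrC addrA subrK.
    by rewrite addrACA -opprD (addrC a).
  rewrite sqnormZ normrN.
  have m2 : d ^+ 2 <= `|x - (a + 2^-1 *: (b - a))| ^+ 2.
    by rewrite ler_sqr ?nnegrE ?dle.
  have a2 : `|x - a| ^+ 2 <= (d + e) ^+ 2 by rewrite ler_sqr ?nnegrE//; lra.
  have b2 : `|x - b| ^+ 2 <= (d + e) ^+ 2 by rewrite ler_sqr ?nnegrE//; lra.
  nra.
have ydist e : 0 < e -> \forall n \near \oo, `|x - y n| <= d + e.
  move=> e0; near=> n; have [_ /ltW/le_trans-> //] := yP n.
  rewrite lerD2l ltW//; near: n.
  exact: (near_infty_natSinv_lt (PosNum e0)).
have ycvg : cvgn y.
  apply/cauchy_cvgP/cauchy_exP => e e0.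
  (* Since [r <= 1], the bound [4 r (2 d + r)] of [close] is strictly below
     [4 r (2 d + 2) <= e^2]. *)
  pose r := Num.min 1 (e ^+ 2 / (4 * (2 * d + 2))).
  have d4 : 0 < 4 * (2 * d + 2) by lra.
  have r0 : 0 < r by rewrite lt_min ltr01/= divr_gt0// exprn_gt0.
  have r1 : r <= 1 by rewrite ge_min lexx.
  have re : r * (4 * (2 * d + 2)) <= e ^+ 2.
    by rewrite -ler_pdivlMr// ge_min lexx orbT.
  have [n0 _ n0P] := ydist r r0.
  exists (y n0); exists n0 => // n /= n0n.
  rewrite -ball_normE/= -(@ltr_sqr _ `|_|) ?nnegrE// 1?ltW//.
  have := close _ _ r r0 (yP n0).1 (yP n).1 (n0P _ (leqnn n0)) (n0P _ n0n).
  move/le_lt_trans; apply.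
  nra.
exists (lim (y @ \oo)); split.
  by apply: (closed_cvg C Ccl _ _ ycvg); apply: nearW => n; case: (yP n).
move=> z /dle; apply: le_trans.
apply/ler_addgt0Pr => e e0.
apply: cvgr_to_le (ydist e e0).
by apply: cvg_norm; apply: cvgB => //; exact: cvg_cst.
Unshelve. all: by end_near. Qed.

(** For the nearest point [p], both [p + v] and [p - v] lie in [V], so the variational inequality
    holds with both signs. *)
Lemma orthogonal_projection V x : closed V -> V 0 ->
  (forall a v w, V v -> V w -> V (a *: v + w)) ->
  exists2 p, V p & forall v, V v -> dot (x - p) v = 0.
Proof.
move=> Vcl V0 Vlin.
have VZ a v : V v -> V (a *: v).
  by move=> Vv; rewrite -[_ *: _]addr0; exact: Vlin.
have VD v w : V v -> V w -> V (v + w).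
  by move=> Vv Vw; rewrite -[v]scale1r; exact: Vlin.
have VB v w : V v -> V w -> V (v - w).
  by move=> Vv Vw; rewrite -scaleN1r; apply: VD => //; exact: VZ.
have Vconv a b t : V a -> V b -> 0 <= t <= 1 -> V (a + t *: (b - a)).
  by move=> Va Vb _; apply: VD => //; apply: VZ; exact: VB.
have [|p pP] := nearest_points_neq0 x Vcl _ Vconv; first by exists 0.
have Vp := pP.1.
exists p => // v Vv; apply/eqP; rewrite eq_le.
have var := nearest_variational dot_norm Vconv pP.
have /var := VD _ _ Vp Vv; rewrite addrAC subrr add0r => ->/=.
have /var := VB _ _ Vp Vv.
by rewrite addrAC subrr add0r linearNr oppr_le0.
Qed.

(** The component [q] of some [v0] outside the kernel, orthogonal to the kernel, spans a complement:
    [v - (f v / f q) q] is in the kernel for every [v]. Linearity is an explicit hypothesis so that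
    the lemma also applies to a limit of functionals. *)
Lemma riesz_representation (f : H -> R) :
  (forall a v w, f (a *: v + w) = a * f v + f w) -> continuous f ->
  exists z, forall v, f v = dot z v.
Proof.
move=> flin fcont.
have f0 : f 0 = 0.
  by have := flin (-1) 0 0; rewrite scaler0 addr0; lra.
have fZ a v : f (a *: v) = a * f v by rewrite -[_ *: _]addr0 flin f0 addr0.
have fB v w : f (v - w) = f v - f w.
  by rewrite addrC -scaleN1r flin mulN1r addrC.
have [f0'|/existsNP[v0 /eqP fv0]] := pselect (forall v, f v = 0).
  by exists 0 => v; rewrite f0' linear0l.
have [|||p Kp pP] := @orthogonal_projection [set v | f v = 0] v0.
- by apply: (@preimage_closed _ _ f [set 0 : R]) => //; exact: closed_eq.
- exact: f0.
- by move=> a v w /= fv fw; rewrite flin fv fw mulr0 addr0.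
pose q := v0 - p.
have fq : f q = f v0 by rewrite fB Kp subr0.
have q0 : `|q| ^+ 2 != 0.
  rewrite sqrf_eq0 normr_eq0; apply/negP => /eqP q0.
  by move: fv0; rewrite -fq q0 f0 eqxx.
exists ((f q / `|q| ^+ 2) *: q) => v.
have /pP : [set v | f v = 0] (v - (f v / f q) *: q).
  by rewrite /= fB fZ divfK ?subrr// fq.
rewrite -/q linearBr/= dotZr -dot_norm => /eqP; rewrite subr_eq0 => /eqP qv.
rewrite dotZl qv mulrA mulrAC divfK// mulrC divfK ?fq//.
Qed.

End Hilbert.

(** * Weak sequential compactness of bounded sequences *)

Lemma ultra_bounded_cvg (R : realType) (T : Type) (U : set_system T)
    (f : T -> R) (M : R) :
  UltraFilter U -> (forall t, `|f t| <= M) -> cvg (f @ U).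
Proof.
move=> UU fM; have UP : ProperFilter U by exact: ultra_proper.
have [|a [_ fa]] := @segment_compact R (- M) M (f @ U) _.
  by apply: (@filterE _ U) => t; rewrite /= in_itv/= -ler_norml.
apply: (@cvgP _ _ (a : R)); apply/cvgrPdist_lt => e e0.
(* The ultrafilter contains the preimage of the ball or its complement; the latter would contradict
   that [a] is a cluster point. *)
have [//|Uc] := in_ultra_setVsetC [set t | `|a - f t| < e] UU.
have [b [+]] :=
  fa [set b | ~ (`|a - b| < e)] (ball a e) Uc (nbhsx_ballx a e e0).
by rewrite -ball_normE.
Qed.

Section WeakCompactness.
Context (R : realType) (H : completeNormedModType R)
  (dot : {dot H for @idfun R}) (dot_norm : induces_norm dot).
Implicit Types (v z : H) (y : nat -> H).

(** The bound [M] makes the functionals [dot (y n)] equicontinuous, so convergence to 0 passes to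
    limits of directions. *)
Lemma closed_weak_null y M : (forall n, `|y n| <= M) ->
  closed [set v | (fun n => dot (y n) v) @ \oo --> (0 : R)].
Proof.
move=> yM v clv; apply/cvgr0Pnorm_le => e e0.
have M0 : 0 <= M := le_trans (normr_ge0 _) (yM 0%N).
have M1 : 0 < M + 1 by lra.
have r0 : 0 < e / 2 / (M + 1) by rewrite !divr_gt0.
have [w [/= w0]] := clv _ (nbhsx_ballx v _ r0).
rewrite -ball_normE/= ltr_pdivlMr// => vw.
have e2 : 0 < e / 2 by rewrite divr_gt0.
near=> n.
have -> : dot (y n) v = dot (y n) (v - w) + dot (y n) w.
  by rewrite -linearDr/= subrK.
have nw : `|dot (y n) w| <= e / 2 by near: n; apply: cvgr0_norm_le.
rewrite (le_trans (ler_normD _ _))// (splitr e) lerD//.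
rewrite (le_trans (cauchy_schwarz dot_norm _ _))//.
have := yM n; have := normr_ge0 (y n); have := normr_ge0 (v - w); nra.
Unshelve. all: by end_near. Qed.

(* [z] is the weak limit along an ultrafilter.  The indices [k m] are chosen so
   that [y (k m) - z] tends to 0 along every [y j]; vectors orthogonal to all
   the [y j] are also orthogonal to [z], so the closed subspace of directions
   along which [y (k m) - z] tends to 0 is the whole space. *)
Lemma weak_sequential_compactness y M : (forall n, `|y n| <= M) ->
  exists z, exists2 k : nat -> nat, (forall m, (m <= k m)%N) &
    forall v, (fun m => dot (y (k m)) v) @ \oo --> (dot z v : R).
Proof.
move=> yM.
have [U [UU ooU]] := ultraFilterLemma eventually_filter.
have UP : ProperFilter U by exact: ultra_proper.
have M0 : 0 <= M := le_trans (normr_ge0 _) (yM 0%N).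
have dotM v n : `|dot (y n) v| <= M * `|v|.
  by rewrite (le_trans (cauchy_schwarz dot_norm _ _))// ler_wpM2r.
pose f v := lim ((fun n => dot (y n) v) @ U).
have fP v : (fun n => dot (y n) v) @ U --> f v.
  exact: ultra_bounded_cvg UU (dotM v).
have flin a v w : f (a *: v + w) = a * f v + f w.
  apply: cvg_lim => //.
  under eq_fun do rewrite linearDr/= dotZr.
  by apply: cvgD => //; apply: cvgM => //; exact: cvg_cst.
have fM v : `|f v| <= M * `|v|.
  by apply: (cvgr_to_le (cvg_norm (fP v))); apply: nearW => n; exact: dotM.
have fcont : continuous f.
  move=> v; apply/cvgrPdist_le => /= e e0.
  have M1 : 0 < M + 1 by lra.
  near=> w.
  have -> : f v - f w = f (v - w).
    by rewrite [v - w]addrC -(scaleN1r w) flin; ring.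
  have vw : `|v - w| <= e / (M + 1).
    by near: w; apply: cvgr_dist_le => //; rewrite divr_gt0.
  move: vw; rewrite ler_pdivlMr// => vw; have := fM (v - w).
  have := normr_ge0 (v - w); nra.
have [z zP] := riesz_representation dot_norm flin fcont.
have /choice[k kP] m : exists n, (m <= n)%N /\
    forall j : 'I_m, `|dot z (y j) - dot (y n) (y j)| < m.+1%:R^-1.
  (* Only finitely many conditions are imposed, each holding on a set of [U]; [m <= n] is one
     because [U] refines the eventual filter. *)
  apply: (@filter_ex _ U); near=> n; split.
    by near: n; apply: ooU; exact: nbhs_infty_ge.
  near: n; apply: filter_forall => j; rewrite -zP.
  by move/cvgrPdist_lt : (fP (y j)); apply; rewrite invr_gt0.
exists z, k => [m|v]; first by case: (kP m).
pose e m := y (k m) - z.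
have eM m : `|e m| <= M + `|z|.
  by rewrite (le_trans (ler_normB _ _))// lerD.
pose V := [set v | (fun m => dot (e m) v) @ \oo --> (0 : R)].
have Vlin a v1 v2 : V v1 -> V v2 -> V (a *: v1 + v2).
  move=> V1 V2; rewrite /V /=.
  under eq_fun do rewrite linearDr/= dotZr.
  suff : (fun m => a * dot (e m) v1 + dot (e m) v2) @ \oo --> (a * 0 + 0 : R).
    by rewrite mulr0 addr0.
  by apply: cvgD => //; apply: cvgM => //; exact: cvg_cst.
have V0 : V 0.
  by rewrite /V /=; under eq_fun do rewrite linear0r; exact: cvg_cst.
have Vy j : V (y j).
  apply/cvgr0Pnorm_lt => r r0; near=> m.
  have jm : (j < m)%N by near: m; exact: nbhs_infty_gt.
  rewrite linearBl/= distrC (lt_trans ((kP m).2 (Ordinal jm)))//.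
  by near: m; exact: (near_infty_natSinv_lt (PosNum r0)).
have [p Vp pP] :=
  orthogonal_projection dot_norm v (closed_weak_null eM) V0 Vlin.
have yq j : dot (y j) (v - p) = 0 by rewrite dotC; exact/pP/Vy.
have zq : dot z (v - p) = 0.
  rewrite -zP; apply: cvg_lim => //.
  by under eq_fun do rewrite yq; exact: cvg_cst.
have dotp x : dot x (v - p) = 0 -> dot x v = dot x p.
  by move=> x0; rewrite -{1}(subrK p v) linearDr/= x0 add0r.
apply/subr_cvg0; apply: cvg_trans Vp; apply: near_eq_cvg; apply: nearW => m.
by rewrite /e linearBl/= (dotp _ (yq _)) (dotp _ zq).
Unshelve. all: by end_near. Qed.

End WeakCompactness.

(** * Fixed point sets and uniform versions of the sequential hypotheses *)

Section FixedPoints.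
Context (R : realType) (H : completeNormedModType R)
  (dot : {dot H for @idfun R}) (dot_norm : induces_norm dot).
Implicit Types (T : H -> H) (p u w y z : H).

(* This exhibits [Fix T] as an intersection of half-spaces. *)
Lemma Fix_quasinonexpansiveE T : quasinonexpansive T ->
  Fix T = [set z | forall x, `|T x - z| <= `|x - z|].
Proof.
move=> [_ Tqne]; apply/seteqP; split=> z; first by move=> Tz x; exact: Tqne.
by move=> /(_ z); rewrite subrr normr0 normr_le0 subr_eq0 => /eqP.
Qed.

Lemma Fix_closed T : quasinonexpansive T -> closed (Fix T).
Proof.
move=> /Fix_quasinonexpansiveE->.
rewrite (_ : [set z | _] =
  \bigcap_x [set z | `|T x - z| <= `|x - z|]); last first.
  by apply/seteqP; split=> z zP x; [move=> _|]; exact: zP.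
apply: closed_bigI => x _.
rewrite (_ : mkset _ =
  (fun z => `|T x - z| - `|x - z|) @^-1` [set r | r <= 0]); last first.
  by apply/seteqP; split=> z /=; rewrite subr_le0.
apply: preimage_closed; last exact: closed_le.
move=> z _; apply: cvgB; apply: cvg_norm; apply: cvgB => //; exact: cvg_cst.
Qed.

(** After squaring [|T x - z| <= |x - z|], the terms [|z|^2] cancel and the inequality is affine in
    [z]. *)
Lemma Fix_convex T a b (t : R) : quasinonexpansive T ->
  Fix T a -> Fix T b -> 0 <= t <= 1 -> Fix T (a + t *: (b - a)).
Proof.
move=> /Fix_quasinonexpansiveE->/= aP bP /andP[t0 t1] x.
have := aP x; have := bP x.
rewrite -!(@ler_sqr _ `|T x - _|) ?nnegrE// !(sqnormB dot_norm _ a).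
rewrite !(sqnormB dot_norm _ b) !(sqnormB dot_norm _ (a + _)).
rewrite !linearDr/= !dotZr !linearBr/=; nra.
Qed.

(** If no [d] worked, counterexamples for [d = 1 / (n + 1)] would form a bounded sequence
    contradicting the sequential definition. The uniform [d] is what can be applied to a single
    iterate. *)
Lemma strongly_quasinonexpansive_uniform T p (M e : R) :
  strongly_quasinonexpansive T -> Fix T p -> 0 < e ->
  exists2 d : R, 0 < d & forall y, `|y - p| <= M ->
    `|y - p| - `|T y - p| < d -> `|T y - y| < e.
Proof.
move=> [[_ Tqne] Tsq] Tp e0; apply: contrapT => h.
have /choice[y yP] (n : nat) : exists y, [/\ `|y - p| <= M,
    `|y - p| - `|T y - p| < n.+1%:R^-1 & e <= `|T y - y|].
  apply: contrapT => hn; apply: h; exists n.+1%:R^-1; first by rewrite invr_gt0.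
  move=> y yM yd; rewrite ltNge; apply/negP => ye; apply: hn.
  by exists y.
have ybnd : bounded_fun y.
  exists (M + `|p|); split; first exact: num_real.
  move=> r Mr n _ /=; rewrite (le_trans _ (ltW Mr))//.
  by rewrite -[y n](subrK p) (le_trans (ler_normD _ _))// lerD2r; case: (yP n).
have ycvg : (fun n => `|y n - p| - `|T (y n) - p|) @ \oo --> (0 : R).
  apply/cvgr0Pnorm_lt => r r0; near=> n.
  have [_ yn _] := yP n.
  rewrite ger0_norm ?subr_ge0 ?Tqne// (lt_trans yn)//.
  by near: n; exact: (near_infty_natSinv_lt (PosNum r0)).
have Ty0 : (fun n => T (y n) - y n) @ \oo --> (0 : H).
  by apply: Tsq => //; exists p.
have /cvgr0Pnorm_lt/(_ _ e0)[n _ /(_ n (leqnn n))] := Ty0.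
by case: (yP n) => _ _ /le_lt_trans/[apply]; rewrite ltxx.
Unshelve. all: by end_near. Qed.

Lemma small_residuals_dot_le (I : Type) (S : I -> H -> H) u w (M e : R) :
  (forall i, asymptotic_Fix (S i) = Fix (S i)) ->
  (forall z, (\bigcap_i Fix (S i)) z -> dot (u - w) (z - w) <= 0) -> 0 < e ->
  exists2 d : R, 0 < d & forall y, `|y - w| <= M ->
    (forall i, `|S i y - y| < d) -> dot (u - w) (y - w) <= e.
Proof.
move=> Sasym Fw e0; apply: contrapT => h.
have /choice[y yP] (n : nat) : exists y, [/\ `|y - w| <= M,
    forall i, `|S i y - y| < n.+1%:R^-1 & e <= dot (u - w) (y - w)].
  apply: contrapT => hn; apply: h; exists n.+1%:R^-1; first by rewrite invr_gt0.
  move=> y yM yd; rewrite leNgt; apply/negP => /ltW ye; apply: hn.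
  by exists y.
have yM n : `|y n| <= M + `|w|.
  by rewrite -[y n](subrK w) (le_trans (ler_normD _ _))// lerD2r; case: (yP n).
have [z [k km kz]] := weak_sequential_compactness dot_norm yM.
have /Fw : (\bigcap_i Fix (S i)) z.
  move=> i _; rewrite -Sasym; exists (y \o k); split.
    apply/cvgr0Pnorm_lt => r r0; near=> n.
    have [_ /(_ i) yn _] := yP (k n).
    rewrite distrC (lt_trans yn)//.
    (* Since [n <= k n], the residual bound [1 / (k n + 1)] is at most [1 / (n + 1)]. *)
    apply: (@le_lt_trans _ _ n.+1%:R^-1).
      by rewrite lef_pV2 ?posrE// ler_nat ltnS.
    by near: n; exact: (near_infty_natSinv_lt (PosNum r0)).
  (* By Riesz, weak convergence need only be tested against inner products. *)
  move=> f fcont.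
  have flin b v v' : f (b *: v + v') = b * f v + f v' by exact: linearP.
  have [a fa] := riesz_representation dot_norm flin fcont.
  rewrite fa dotC; under eq_fun do rewrite /= fa dotC.
  exact: kz.
rewrite leNgt => /negP; apply.
rewrite (lt_le_trans e0)//.
apply: (cvgr_to_ge (F := \oo) (f := fun n => dot (u - w) (y (k n) - w))).
  under eq_fun do rewrite linearBr/= dotC.
  rewrite linearBr/= [dot _ z]dotC.
  by apply: cvgB; [exact: kz|exact: cvg_cst].
by apply: nearW => n; case: (yP (k n)).
Unshelve. all: by end_near. Qed.

End FixedPoints.

(** * A scalar recursion and the convergence of the iterates *)

(** Once [s] is at most [2 e] it stays there, the recursion being a convex combination. While
    [s n > 2 e], each step loses at least [alpha n * e], which cannot go on forever because the
    series diverges. *)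
Lemma recursion_limsup_le (R : realType) (s alpha : nat -> R) (e : R) :
  0 < e -> (forall n, 0 < alpha n <= 1) -> series alpha @ \oo --> +oo ->
  (\forall n \near \oo, s n.+1 <= (1 - alpha n) * s n + alpha n * e) ->
  \forall n \near \oo, s n <= 2 * e.
Proof.
move=> e0 alpha01 alpha_sum [n0 _ sP].
have [[m [n0m sm]]|big] := pselect (exists m, (n0 <= m)%N /\ s m <= 2 * e).
  exists m => // n /= mn; rewrite -(subnK mn) addnC.
  elim: (n - m)%N => [|k IH]; first by rewrite addn0.
  rewrite addnS; apply: (le_trans (sP _ (leq_trans n0m (leq_addr _ _)))).
  have /andP[a0 a1] := alpha01 (m + k)%N; nra.
have {}big n : (n0 <= n)%N -> 2 * e < s n.
  by move=> n0n; rewrite ltNge; apply/negP => sn; apply: big; exists n.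
pose B := s n0 + e * series alpha n0.
(* [series alpha n] sums the indices below [n], so passing to [n + 1] adds exactly the [alpha n] of
   the recursion. *)
have inv k : s (n0 + k)%N + e * series alpha (n0 + k)%N <= B.
  elim: k => [|k IH]; first by rewrite addn0.
  rewrite addnS; apply: le_trans IH.
  rewrite /series/= big_nat_recr//=.
  have := sP _ (leq_addr k n0); have := big _ (leq_addr k n0).
  have /andP[a0 a1] := alpha01 (n0 + k)%N; nra.
have : \forall n \near \oo, (n0 <= n)%N /\ B / e <= series alpha n.
  near=> n; split; first by near: n; exact: nbhs_infty_ge.
  by near: n; move/cvgryPge : alpha_sum; exact.
move=> /filter_ex[n [n0n]]; rewrite ler_pdivrMr// => Bn.
have := inv (n - n0)%N; rewrite subnKC// => sn; have := big _ n0n; nra.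
Unshelve. all: by end_near. Qed.

Theorem theorem4p1 (R : realType) (H : completeNormedModType R)
    (dot : {dot H for @idfun R}) (H_hilbert : induces_norm dot)
    (N : nat) (N_gt0 : (0 < N)%N) (S : 'I_N -> H -> H)
    (S_sqne : forall i, strongly_quasinonexpansive (S i))
    (F_neq0 : (\bigcap_(i in [set: 'I_N]) Fix (S i)) !=set0)
    (S_asym : forall i, asymptotic_Fix (S i) = Fix (S i))
    (u : H) (alpha : nat -> R) (alpha01 : forall n, 0 < alpha n <= 1)
    (x : nat -> H) (i_ : nat -> 'I_N)
    (i_argmax : forall n,
      argmax (fun i => `|S i (x n) - x n|) (i_ n))
    (x_rec : forall n,
      x n.+1 = alpha n *: u + (1 - alpha n) *: S (i_ n) (x n))
    (alpha_sum : series alpha @ \oo --> +oo)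
    (alpha_cvg : alpha @ \oo --> (0 : R)) :
  x @ \oo --> metric_projection (\bigcap_(i in [set: 'I_N]) Fix (S i)) u.
Proof.
set F := \bigcap_(i in _) _; set w := metric_projection F u.
have Sqne i : quasinonexpansive (S i) := (S_sqne i).1.
have Fconv a b (t : R) : F a -> F b -> 0 <= t <= 1 -> F (a + t *: (b - a)).
  move=> Fa Fb t01 i _.
  by apply: (Fix_convex H_hilbert) => //; [exact: Fa|exact: Fb].
have wP : nearest_points F u w.
  have Fcl : closed F by apply: closed_bigI => i _; exact: Fix_closed.
  have [p pP] := nearest_points_neq0 H_hilbert u Fcl F_neq0 Fconv.
  (* The witness [p] rules out the default value of [xget]. *)
  by rewrite /w /metric_projection; exact: xgetI pP.
have Fw : F w := wP.1.
have Sw y i : `|S i y - w| <= `|y - w| by apply: (Sqne i).2; exact: Fw.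
(* The closed ball of radius [M] about [w] contains the start and the anchor [u], hence all
   iterates. *)
pose M := Num.max `|x 0%N - w| `|u - w|.
have uM : `|u - w| <= M by rewrite le_max lexx orbT.
have M0 : 0 <= M := le_trans (normr_ge0 _) uM.
have recE n : x n.+1 - w =
    alpha n *: (u - w) + (1 - alpha n) *: (S (i_ n) (x n) - w).
  rewrite x_rec !scalerBr addrACA -opprD -scalerDl.
  by rewrite [alpha n + _]addrC subrK scale1r.
have rec_norm n : `|x n.+1 - w| <=
    alpha n * `|u - w| + (1 - alpha n) * `|S (i_ n) (x n) - w|.
  have /andP[a0 a1] := alpha01 n.
  rewrite recE (le_trans (ler_normD _ _))// !normrZ.
  by rewrite (ger0_norm (ltW a0)) (@ger0_norm _ (1 - _)) ?subr_ge0.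
have xM n : `|x n - w| <= M.
  elim: n => [|n IH]; first by rewrite le_max lexx.
  apply: (le_trans (rec_norm n)).
  have /andP[a0 a1] := alpha01 n; have := Sw (x n) (i_ n); nra.
suff sqcvg e : 0 < e -> \forall n \near \oo, `|x n - w| ^+ 2 <= 2 * (5 * e).
  apply/cvgrPdist_le => e e0; near=> n.
  rewrite distrC -(@ler_sqr _ `|_|) ?nnegrE ?(ltW e0)//.
  have -> : e ^+ 2 = 2 * (5 * (e ^+ 2 / 10)) by field.
  by near: n; apply: sqcvg; rewrite divr_gt0// exprn_gt0.
move=> e0.
apply: (@recursion_limsup_le _ (fun n => `|x n - w| ^+ 2) alpha) => //.
  by rewrite mulr_gt0.
have M2 : 0 < M ^+ 2 + 1 by have := sqr_ge0 M; lra.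
have [d d0 dP] := small_residuals_dot_le H_hilbert M S_asym
  (nearest_variational H_hilbert Fconv wP) e0.
(* [r <= d] lets [dP] apply, and [r (M + 1) <= e] bounds [dot (u - w) (S y - y)] by [e] through
   Cauchy-Schwarz. Adding 1 keeps the denominator positive when [M = 0]. *)
pose r := Num.min d (e / (M + 1)).
have M1 : 0 < M + 1 by lra.
have r0 : 0 < r by rewrite lt_min d0/= divr_gt0.
have rd : r <= d by rewrite ge_min lexx.
have rM : r * (M + 1) <= e by rewrite -ler_pdivlMr// ge_min lexx orbT.
have /choice[h hP] i : exists h : R, 0 < h /\ forall y, `|y - w| <= M ->
    `|y - w| - `|S i y - w| < h -> `|S i y - y| < r.
  have [h h0 hP] := strongly_quasinonexpansive_uniform M (S_sqne i) (Fw i I) r0.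
  by exists h.
have alpha_small c : 0 < c -> \forall n \near \oo, alpha n <= c.
  move=> c0; near=> n; apply: (le_trans (ler_norm _)).
  by near: n; exact: cvgr0_norm_le.
have drop i : \forall n \near \oo,
    alpha n * M <= h i / 2 /\ alpha n * M ^+ 2 <= (h i / 2) ^+ 2.
  have h0 : 0 < h i / 2 by rewrite divr_gt0// (hP i).1.
  near=> n; have /andP[a0 _] := alpha01 n.
  have : alpha n <= h i / 2 / (M + 1).
    by near: n; apply: alpha_small; rewrite divr_gt0.
  have : alpha n <= (h i / 2) ^+ 2 / (M ^+ 2 + 1).
    by near: n; apply: alpha_small; rewrite divr_gt0// exprn_gt0.
  by rewrite !ler_pdivlMr// => ? ?; split; lra.
near=> n.
have /andP[a0 a1] := alpha01 n.
have [aM aM2] : alpha n * M <= h (i_ n) / 2 /\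
    alpha n * M ^+ 2 <= (h (i_ n) / 2) ^+ 2.
  (* The index set is finite, so the thresholds hold eventually for all [i] at once, whatever the
     choice of [i_ n]. *)
  by move: (i_ n); near: n; apply: filter_forall => i; exact: drop.
have [hi0 hi] := hP (i_ n).
have Si := Sw (x n) (i_ n).
have [small|large] := ltP (`|x n - w| - `|S (i_ n) (x n) - w|) (h (i_ n)).
- have res := hi _ (xM n) small.
  have xw : dot (u - w) (x n - w) <= e.
    apply: dP => // j; apply: le_lt_trans (i_argmax n j) _.
    exact: lt_le_trans res rd.
  have sw : dot (u - w) (S (i_ n) (x n) - x n) <= e.
    have := dot_le H_hilbert (u - w) (S (i_ n) (x n) - x n).
    have := normr_ge0 (u - w); have := normr_ge0 (S (i_ n) (x n) - x n); nra.
  have aMe : alpha n * M ^+ 2 <= e.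
    have : alpha n <= e / (M ^+ 2 + 1).
      by near: n; apply: alpha_small; rewrite divr_gt0.
    rewrite ler_pdivlMr//; lra.
  have dotE : dot (u - w) (S (i_ n) (x n) - w) =
      dot (u - w) (x n - w) + dot (u - w) (S (i_ n) (x n) - x n).
    by rewrite [RHS]addrC -linearDr/= addrA subrK.
  (* The squared anchor term contributes at most [alpha n * e] ([h1]) and the doubled cross term at
     most [4 * alpha n * e] ([h2]), whence the constant 5. *)
  rewrite recE (sqnormD H_hilbert) !sqnormZ dotZl dotZr dotE.
  have : `|u - w| ^+ 2 <= M ^+ 2 by rewrite ler_sqr ?nnegrE.
  have : `|S (i_ n) (x n) - w| ^+ 2 <= `|x n - w| ^+ 2.
    by rewrite ler_sqr ?nnegrE.
  move: xw sw (sqr_ge0 `|S (i_ n) (x n) - w|).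
  set A := dot _ _; set B := dot _ _.
  set q2 := _ ^+ 2; set s := _ ^+ 2; set v := _ ^+ 2.
  move=> Ae Be q0 qs vM.
  have h1 : alpha n * (alpha n * v) <= alpha n * e.
    by rewrite ler_pM2l// (le_trans _ aMe)// ler_pM2l.
  have h2 : alpha n * ((1 - alpha n) * (A + B)) <= alpha n * (2 * e).
    by rewrite ler_pM2l//; nra.
  have h3 : (1 - alpha n) ^+ 2 * q2 <= (1 - alpha n) * s.
    rewrite expr2 -mulrA ler_wpM2l ?subr_ge0// (le_trans _ qs)//.
    by rewrite ler_piMl//; lra.
  nra.
- have := rec_norm n; have := xM n; have := normr_ge0 (S (i_ n) (x n) - w).
  have := normr_ge0 (x n.+1 - w).
  move: large aM aM2 hi0 uM.
  set c := h _; set q := `|S _ _ - w|; set p := `|x n.+1 - w|.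
  set v := `|u - w|; set b := `|x n - w|.
  move=> large aM aM2 c0 vM p0 q0 bM pq.
  (* The drop [c] outweighs [alpha n * v <= c / 2]. As [b >= c], squaring loses at least
     [b c - c^2 / 4 >= (c / 2)^2], which covers [alpha n * b^2]. *)
  have pb : p <= b - c / 2 by nra.
  have : p ^+ 2 <= (b - c / 2) ^+ 2 by rewrite ler_sqr ?nnegrE//; lra.
  have : alpha n * b ^+ 2 <= (c / 2) ^+ 2.
    by apply: le_trans aM2; rewrite ler_pM2l// ler_sqr ?nnegrE//; lra.
  nra.
Unshelve. all: by end_near. Qed.
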